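(* There exist no totally umbilical proper QGCR-lightlike submanifolds $(M,g,S(TM),S(TM^\perp))$, with totally umbilical screen distributions, of an indefinite nearly Sasakian manifold $(\overline{M},\overline{\phi},\eta,\xi,\overline{g})$ with the structure vector field $\xi$ transversal to $M$ (that is, $\xi\in\Gamma(\mathrm{tr}(TM))$ along $M$).
   Context: Notation: $\Gamma(\Xi)$ is the set of smooth sections of a vector bundle $\Xi$. Indefinite nearly Sasakian manifold: a $(2n+1)$-dimensional manifold $\overline{M}$ with a $(1,1)$-tensor $\overline{\phi}$, a vector field $\xi$, a 1-form $\eta$ and a semi-Riemannian metric $\overline{g}$ with Levi-Civita connection $\overline{\nabla}$ such that $\overline{\phi}^2=-I+\eta\otimes\xi$, $\eta(\xi)=1$, $\eta\circ\overline{\phi}=0$, $\overline{\phi}\xi=0$, $\overline{g}(\overline{\phi}X,\overline{\phi}Y)=\overline{g}(X,Y)-\eta(X)\eta(Y)$ (hence $\eta=\overline{g}(\xi,\cdot)$), and $(\overline{\nabla}_X\overline{\phi})Y+(\overline{\nabla}_Y\overline{\phi})X=2\overline{g}(X,Y)\xi-\eta(Y)X-\eta(X)Y$ for all $X,Y$. Lightlike submanifold: a submanifold $M$ of $\overline{M}$, with $g$ the induced (degenerate) metric, such that $\mathrm{Rad}\,TM=TM\cap TM^\perp$ is a smooth distribution of rank $r>0$. A screen distribution $S(TM)$ is a semi-Riemannian (non-degenerate) complement of $\mathrm{Rad}\,TM$ in $TM$; $S(TM^\perp)$ is a semi-Riemannian complement of $\mathrm{Rad}\,TM$ in $TM^\perp$.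 The lightlike transversal bundle $l\mathrm{tr}(TM)$ is locally spanned by null sections $N_i$ of the orthogonal complement of $S(TM^\perp)$ in $S(TM)^\perp$ with $\overline{g}(E_i,N_j)=\delta_{ij}$, $\overline g(N_i,N_j)=0$ for a local basis $\{E_i\}$ of $\mathrm{Rad}\,TM$. Put $\mathrm{tr}(TM)=l\mathrm{tr}(TM)\perp S(TM^\perp)$, so $T\overline{M}|_M=TM\oplus\mathrm{tr}(TM)=S(TM)\perp S(TM^\perp)\perp\{\mathrm{Rad}\,TM\oplus l\mathrm{tr}(TM)\}$. The Gauss formula is $\overline{\nabla}_XY=\nabla_XY+h(X,Y)$ for $X,Y\in\Gamma(TM)$, with $\nabla_XY\in\Gamma(TM)$ and $h(X,Y)\in\Gamma(\mathrm{tr}(TM))$. With $P$ the projection of $TM$ onto $S(TM)$ along $\mathrm{Rad}\,TM$, write $\nabla_XPY=\nabla^*_XPY+\sum_{i=1}^r h_i^*(X,PY)E_i$ with $\nabla^*_XPY\in\Gamma(S(TM))$; the $h_i^*$ are the second fundamental forms of $S(TM)$. $M$ is totally umbilical if there is a smooth $\mathcal{H}\in\Gamma(\mathrm{tr}(TM))$ with $h(X,Y)=\mathcal{H}g(X,Y)$ for all $X,Y\in\Gamma(TM)$. The screen distribution is totally umbilical if, locally, there are smooth functions $K_i$ with $h_i^*(X,PY)=K_i\,g(X,PY)$ for all $X,Y\in\Gamma(TM)$ and all $i$. QGCR-lightlike submanifold: a lightlike submanifold $(M,g,S(TM),S(TM^\perp))$ of $\overline{M}$ is Quasi Generalized Cauchy-Riemann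 (QGCR) if (i) there are distributions $D_1,D_2$ of $\mathrm{Rad}\,TM$ with $\mathrm{Rad}\,TM=D_1\oplus D_2$, $\overline{\phi}D_1=D_1$, $\overline{\phi}D_2\subset S(TM)$; (ii) there are subbundles $D_0,\overline{D}$ of $S(TM)$ with $S(TM)=\{\overline{\phi}D_2\oplus\overline{D}\}\perp D_0$, $\overline{\phi}D_0\subseteq D_0$, $\overline{D}=\overline{\phi}\mathcal{S}\oplus\overline{\phi}\mathcal{L}$, where $D_0$ is non-degenerate and $\mathcal{L}$, $\mathcal{S}$ are vector subbundles of $l\mathrm{tr}(TM)$ and $S(TM^\perp)$ respectively. In (ii) the symbol $\oplus$ denotes a (not necessarily orthogonal) sum of subbundles, and the summands $\overline{\phi}D_2$ and $\overline{\phi}\mathcal{L}$ are allowed to intersect. $M$ is proper if $D_0,D_1,D_2,\mathcal{S}$ are all nonzero. *)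

(* Defs.v *)
From HB Require Import structures.
From mathcomp Require Import all_boot all_order all_algebra.
From mathcomp Require Import all_classical all_reals all_analysis.

Set Implicit Arguments.
Unset Strict Implicit.
Unset Printing Implicit Defensive.

Import Order.TTheory GRing.Theory Num.Theory.
Import numFieldNormedType.Exports.

Local Open Scope classical_set_scope.
Local Open Scope ring_scope.

(** * Smooth manifolds *)

(* For open [A]: all iterated directional derivatives exist and are
   (Frechet) differentiable on [A], i.e. [f] is of class C^oo on [A]. *)
Definition Cinf_on {R : realType} {V W : normedModType R} (A : set V)
    (f : V -> W) : Prop :=
  forall (vs : seq V) (x : V), A x ->
    differentiable (foldr (fun v h y => 'D_v h y) f vs) x.

(* [cinv] is total, and significant only on the image of [cdom]. *)
Record chart (R : realType) (T : topologicalType) (d : nat) := Chart {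
  cdom : set T;
  cmap : T -> 'rV[R]_d;
  cinv : 'rV[R]_d -> T;
  cdom_open : open cdom;
  cimg_open : open (cmap @` cdom);
  cmapK : forall p, cdom p -> cinv (cmap p) = p;
  cmap_continuous : {within cdom, continuous cmap};
  cinv_continuous : {within cmap @` cdom, continuous cinv} }.

Record manifold (R : realType) (d : nat) := Manifold {
  mcarrier :> topologicalType;
  mhausdorff : hausdorff_space mcarrier;
  msecond_countable : @second_countable mcarrier;
  atlas : set (chart R mcarrier d);
  atlas_cover : forall p, exists c, atlas c /\ cdom c p;
  atlas_compat : forall c c', atlas c -> atlas c' ->
    Cinf_on (cmap c @` (cdom c `&` cdom c')) (cmap c' \o cinv c) }.

(* A chosen chart around each point. The tangent space at [p] is represented
   by 'rV[R]_d, a vector being given by its components in [chart_at p]; a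
   vector field is then a function M -> 'rV[R]_d, and its components in any
   other chart are obtained through [dird]. *)
Definition chart_at {R : realType} {d : nat} {M : manifold R d} (p : M) :
    chart R M d :=
  sval (cid (atlas_cover p)).

(* The derivative v(f) of a function f by the tangent vector v at p. *)
Definition dird {R : realType} {d : nat} {M : manifold R d} (p : M)
    (v : 'rV[R]_d) (f : M -> R) : R :=
  'D_v (f \o cinv (chart_at p)) (cmap (chart_at p) p).

Definition smooth_on {R : realType} {d : nat} {M : manifold R d} (U : set M)
    (f : M -> R) : Prop :=
  forall c, atlas c -> Cinf_on (cmap c @` (cdom c `&` U)) (f \o cinv c).

Section Maps.
Context {R : realType} {m d : nat} {M : manifold R m} {N : manifold R d}.

Definition smooth_map (F : M -> N) : Prop :=
  continuous F /\
  forall c c', atlas c -> atlas c' ->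
    Cinf_on (cmap c @` (cdom c `&` F @^-1` cdom c')) (cmap c' \o F \o cinv c).

Definition tangent_map (F : M -> N) (p : M) : 'Hom('rV[R]_m, 'rV[R]_d) :=
  linfun ('d (cmap (chart_at (F p)) \o F \o cinv (chart_at p))
             (cmap (chart_at p) p)).

Definition immersion (F : M -> N) : Prop :=
  smooth_map F /\ forall p, (lker (tangent_map F p) = 0)%VS.

(* Smooth sections over U of the pull-back bundle F^*TN, i.e. smooth vector
   fields along F: Y q is a tangent vector at F q, whose components in a chart
   c of N are the derivatives Y(x^i) of the coordinate functions x^i of c. *)
Definition smooth_along (F : M -> N) (U : set M) (Y : M -> 'rV[R]_d) : Prop :=
  forall c, atlas c -> forall i : 'I_d,
    smooth_on (U `&` F @^-1` cdom c)
      (fun q => dird (F q) (Y q) (fun x => cmap c x ord0 i)).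

Definition dist := M -> {vspace 'rV[R]_d}.

Definition section (F : M -> N) (E : dist) (U : set M) (Y : M -> 'rV[R]_d) :=
  smooth_along F U Y /\ forall q, U q -> Y q \in E q.

Definition frame (F : M -> N) (k : nat) (E : dist) (U : set M)
    (X : 'I_k -> M -> 'rV[R]_d) : Prop :=
  (forall i, section F E U (X i)) /\
  forall q, U q -> basis_of (E q) [tuple X i q | i < k].

(* Smooth subbundles of F^*TN of rank k. *)
Definition subbundle_rank (F : M -> N) (k : nat) (E : dist) : Prop :=
  forall p, exists (U : set M) (X : 'I_k -> M -> 'rV[R]_d),
    [/\ open U, U p & frame F E U X].

Definition subbundle (F : M -> N) (E : dist) : Prop :=
  exists k, subbundle_rank F k E.

Definition nonzero (E : dist) : Prop := exists p, (E p != 0)%VS.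

End Maps.

Arguments dist {R m} d M.

Definition vfield {R : realType} {d : nat} {M : manifold R d} (U : set M)
    (X : M -> 'rV[R]_d) : Prop :=
  smooth_along (@idfun M) U X.

(** * Scalar products on vector spaces *)

Section Forms.
Context {R : realType} {d : nat}.
Implicit Types (B : 'rV[R]_d -> 'rV[R]_d -> R) (U V W : {vspace 'rV[R]_d}).

Definition nondegenerate B U : Prop :=
  forall u, u \in U -> (forall v, v \in U -> B u v = 0) -> u = 0.

Definition orthogonal_to B U V : Prop :=
  forall u v, u \in U -> v \in V -> B u v = 0.

(* See [memv_orthv] below. *)
Definition orthv B U : {vspace 'rV[R]_d} :=
  lker (linfun (fun w => \row_(i < \dim U) B w (vbasis U)`_i)).

Definition direct_sum U V W : Prop := U = (V + W)%VS /\ (V :&: W = 0)%VS.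

Definition negative_definite B U : Prop :=
  forall u, u \in U -> u != 0 -> B u u < 0.

Definition has_index B (k : nat) : Prop :=
  (exists2 U, negative_definite B U & \dim U = k) /\
  (forall U, negative_definite B U -> (\dim U <= k)%N).

Lemma memv_orthv B U w :
  (forall u, scalar (fun v => B v u)) -> (forall u, scalar (B u)) ->
  w \in orthv B U <-> (forall u, u \in U -> B w u = 0).
Proof.
move=> Bl Br; pose f w := \row_(i < \dim U) B w (vbasis U)`_i.
have lf : linear f by move=> a u v; apply/rowP => i; rewrite !mxE Bl.
pose fl := HB.pack_for {linear 'rV[R]_d -> 'rV[R]_(\dim U)} f
  (GRing.isLinear.Build _ _ _ _ f lf).
rewrite /orthv -/f memv_ker (_ : linfun f = linfun fl)// lfunE /=.
have B0 : B w 0 = 0.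
  by have := Br w (-1) 0 0; rewrite scaler0 addr0 /= mulN1r addNr.
split=> [/eqP/rowP fw u uU|h]; last first.
  apply/eqP/rowP => i; rewrite !mxE h// vbasis_mem// mem_nth// size_tuple//.
pose BL := HB.pack_for {linear 'rV[R]_d -> R^o} (B w)
  (GRing.isLinear.Build _ _ _ _ (B w : 'rV[R]_d -> R^o) (Br w)).
rewrite (coord_vbasis uU) -[B w _]/(BL _) linear_sum big1// => i _.
by rewrite linearZ /=; have := fw i; rewrite !mxE => ->; rewrite scaler0.
Qed.

End Forms.

(** * Metrics and connections *)

Record semi_riemannian {R : realType} {d : nat} (N : manifold R d)
    (g : N -> 'rV[R]_d -> 'rV[R]_d -> R) : Prop := SemiRiemannian {
  sr_linear : forall p w, scalar (fun u => g p u w);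
  sr_sym : forall p u w, g p u w = g p w u;
  sr_nondegenerate : forall p, nondegenerate (g p) fullv;
  sr_index : exists k, forall p, has_index (g p) k;
  sr_smooth : forall U X Y, open U -> vfield U X -> vfield U Y ->
    smooth_on U (fun q => g q (X q) (Y q)) }.

(* Linear connections on F^*TN, acting on local sections: [D p v Y] is the
   covariant derivative at p of Y in the direction v, for Y smooth near p. *)
Record connection {R : realType} {m d : nat} {M : manifold R m}
    {N : manifold R d} (F : M -> N)
    (D : M -> 'rV[R]_m -> (M -> 'rV[R]_d) -> 'rV[R]_d) : Prop := Connection {
  cn_linear : forall U p Y, open U -> U p -> smooth_along F U Y ->
    linear (fun v => D p v Y);
  cn_add : forall U p v Y Z, open U -> U p ->
    smooth_along F U Y -> smooth_along F U Z ->
    D p v (fun q => Y q + Z q) = D p v Y + D p v Z;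
  cn_leibniz : forall U p v f Y, open U -> U p ->
    smooth_on U f -> smooth_along F U Y ->
    D p v (fun q => f q *: Y q) = dird p v f *: Y p + f p *: D p v Y;
  cn_smooth : forall U X Y, open U -> vfield U X -> smooth_along F U Y ->
    smooth_along F U (fun q => D q (X q) Y) }.

Record levi_civita {R : realType} {d : nat} (N : manifold R d)
    (g : N -> 'rV[R]_d -> 'rV[R]_d -> R)
    (nabla : N -> 'rV[R]_d -> (N -> 'rV[R]_d) -> 'rV[R]_d) : Prop :=
  LeviCivita {
  lc_connection : connection (@idfun N) nabla;
  (* nabla_X Y - nabla_Y X = [X, Y], as derivations *)
  lc_torsion_free : forall U p X Y f, open U -> U p ->
    vfield U X -> vfield U Y -> smooth_on U f ->
    dird p (nabla p (X p) Y - nabla p (Y p) X) f =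
      dird p (X p) (fun q => dird q (Y q) f) -
      dird p (Y p) (fun q => dird q (X q) f);
  lc_metric : forall U p v Y Z, open U -> U p -> vfield U Y -> vfield U Z ->
    dird p v (fun q => g q (Y q) (Z q)) =
      g p (nabla p v Y) (Z p) + g p (Y p) (nabla p v Z) }.

(* The pull-back by F of a connection on TN: this gives sense to \bar\nabla_X Y for
   fields X, Y defined only along the submanifold. *)
Definition pullback_connection {R : realType} {m d : nat} {M : manifold R m}
    {N : manifold R d} (F : M -> N)
    (nabla : N -> 'rV[R]_d -> (N -> 'rV[R]_d) -> 'rV[R]_d)
    (D : M -> 'rV[R]_m -> (M -> 'rV[R]_d) -> 'rV[R]_d) : Prop :=
  connection F D /\
  forall V p v Z, open V -> V (F p) -> vfield V Z ->
    D p v (Z \o F) = nabla (F p) (tangent_map F p v) Z.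

(** * Indefinite nearly Sasakian manifolds *)

Record nearly_sasakian (R : realType) (n : nat) := NearlySasakian {
  ns_mfd :> manifold R n.*2.+1;
  phi : ns_mfd -> 'End('rV[R]_n.*2.+1);
  xi : ns_mfd -> 'rV[R]_n.*2.+1;
  eta : ns_mfd -> 'rV[R]_n.*2.+1 -> R;
  gbar : ns_mfd -> 'rV[R]_n.*2.+1 -> 'rV[R]_n.*2.+1 -> R;
  nablabar : ns_mfd -> 'rV[R]_n.*2.+1 -> (ns_mfd -> 'rV[R]_n.*2.+1) ->
    'rV[R]_n.*2.+1;
  phi_smooth : forall U X, open U -> vfield U X ->
    vfield U (fun q => phi q (X q));
  xi_smooth : vfield setT xi;
  eta_linear : forall p, scalar (eta p);
  eta_smooth : forall U X, open U -> vfield U X ->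
    smooth_on U (fun q => eta q (X q));
  gbar_semi_riemannian : semi_riemannian gbar;
  nablabar_levi_civita : levi_civita gbar nablabar;
  phi_sqr : forall p u, phi p (phi p u) = - u + eta p u *: xi p;
  eta_xi : forall p, eta p (xi p) = 1;
  eta_phi : forall p u, eta p (phi p u) = 0;
  phi_xi : forall p, phi p (xi p) = 0;
  gbar_phi : forall p u v,
    gbar p (phi p u) (phi p v) = gbar p u v - eta p u * eta p v;
  nearly_sasakianE : forall U p X Y, open U -> U p ->
    vfield U X -> vfield U Y ->
    let nabla_phi X Y :=
      nablabar p (X p) (fun q => phi q (Y q)) - phi p (nablabar p (X p) Y) in
    nabla_phi X Y + nabla_phi Y X =
      (2 * gbar p (X p) (Y p)) *: xi p - eta p (Y p) *: X p
        - eta p (X p) *: Y p }.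

(** * Lightlike submanifolds *)

(* TM as a subbundle of T\bar M along M. *)
Definition TM {R : realType} {m d : nat} {M : manifold R m} {N : manifold R d}
    (F : M -> N) : dist d M :=
  fun p => limg (tangent_map F p).

Definition TMperp {R : realType} {m d : nat} {M : manifold R m}
    {N : manifold R d} (g : N -> 'rV[R]_d -> 'rV[R]_d -> R) (F : M -> N) :
    dist d M :=
  fun p => orthv (g (F p)) (TM F p).

Definition Rad {R : realType} {m d : nat} {M : manifold R m} {N : manifold R d}
    (g : N -> 'rV[R]_d -> 'rV[R]_d -> R) (F : M -> N) : dist d M :=
  fun p => (TM F p :&: TMperp g F p)%VS.

(* All bundles over M are subbundles of T\bar M along M. *)
Record lightlike_submanifold (R : realType) (n : nat)
    (N : nearly_sasakian R n) := LightlikeSubmanifold {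
  ls_dim : nat;
  ls_mfd :> manifold R ls_dim;
  incl : ls_mfd -> N;
  ls_rank : nat;
  STM : dist n.*2.+1 ls_mfd;
  STMperp : dist n.*2.+1 ls_mfd;
  ltr : dist n.*2.+1 ls_mfd;
  (* \bar\nabla on sections of T\bar M along M *)
  nablaM : ls_mfd -> 'rV[R]_ls_dim -> (ls_mfd -> 'rV[R]_n.*2.+1) ->
    'rV[R]_n.*2.+1;
  incl_inj : injective incl;
  incl_immersion : immersion incl;
  ls_rank_gt0 : (0 < ls_rank)%N;
  Rad_bundle : subbundle_rank incl ls_rank (Rad (@gbar R n N) incl);
  STM_bundle : subbundle incl STM;
  STM_compl : forall p,
    direct_sum (TM incl p) (Rad (@gbar R n N) incl p) (STM p);
  STM_nondegenerate : forall p, nondegenerate (gbar (incl p)) (STM p);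
  STMperp_bundle : subbundle incl STMperp;
  STMperp_compl : forall p,
    direct_sum (TMperp (@gbar R n N) incl p) (Rad (@gbar R n N) incl p)
      (STMperp p);
  STMperp_nondegenerate : forall p, nondegenerate (gbar (incl p)) (STMperp p);
  ltr_frames : forall p, exists (U : set ls_mfd)
      (E Nu : 'I_ls_rank -> ls_mfd -> 'rV[R]_n.*2.+1),
    [/\ open U, U p,
      frame incl (Rad (@gbar R n N) incl) U E,
      frame incl ltr U Nu &
      forall q, U q -> forall i j,
        [/\ gbar (incl q) (E i q) (Nu j q) = (i == j)%:R,
          gbar (incl q) (Nu i q) (Nu j q) = 0,
          Nu i q \in orthv (gbar (incl q)) (STM q) &
          Nu i q \in orthv (gbar (incl q)) (STMperp q)]];
  nablaM_pullback : pullback_connection incl (@nablabar R n N) nablaM }.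

Section Lightlike.
Context {R : realType} {n : nat} {N : nearly_sasakian R n}.
Context (M : lightlike_submanifold N).
Local Notation T := 'rV[R]_n.*2.+1.
Local Notation F := (@incl R n N M).
Local Notation g := (@gbar R n N).
Local Notation RadM := (Rad g F).

Definition tr : dist n.*2.+1 M := fun p => (ltr p + STMperp p)%VS.

(* Gauss formula: \bar\nabla_v Y = nabla_v Y + h(v, Y), the decomposition of
   T\bar M = TM (+) tr(TM); here v is a tangent vector to M at p. *)
Definition gauss_nabla (p : M) (v : 'rV[R]_(ls_dim M)) (Y : M -> T) : T :=
  daddv_pi (TM F p) (tr p) (nablaM p v Y).

Definition second_form (p : M) (v : 'rV[R]_(ls_dim M)) (Y : M -> T) : T :=
  daddv_pi (tr p) (TM F p) (nablaM p v Y).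

Definition screen_proj (Y : M -> T) : M -> T :=
  fun q => daddv_pi (STM q) (RadM q) (Y q).

(* h_i^*(v, PY): the E_i-coordinate of the Rad TM-part of nabla_v PY. *)
Definition screen_form (E : 'I_(ls_rank M) -> M -> T) (i : 'I_(ls_rank M))
    (p : M) (v : 'rV[R]_(ls_dim M)) (Y : M -> T) : R :=
  coord [tuple E j p | j < ls_rank M] i
    (daddv_pi (RadM p) (STM p) (gauss_nabla p v (screen_proj Y))).

Definition totally_umbilical : Prop :=
  exists2 H : M -> T, section F tr setT H &
    forall U p v Y, open U -> U p -> section F (TM F) U Y ->
      second_form p v Y = g (F p) (tangent_map F p v) (Y p) *: H p.

Definition screen_totally_umbilical : Prop :=
  forall p0 : M, exists (U : set M) (E : 'I_(ls_rank M) -> M -> T)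
      (K : 'I_(ls_rank M) -> M -> R),
    [/\ open U, U p0, frame F RadM U E, forall i, smooth_on U (K i) &
      forall V p v Y i, open V -> V `<=` U -> V p -> section F (TM F) V Y ->
        screen_form E i p v Y =
          K i p * g (F p) (tangent_map F p v) (screen_proj Y p)].

(* The sums giving \phi D_2 (+) \bar D and \bar D are plain sums of subspaces:
   the summands need be neither orthogonal nor disjoint. *)
Record qgcr (D1 D2 D0 Dbar L S : dist n.*2.+1 M) : Prop := QGCR {
  D1_bundle : subbundle F D1;
  D2_bundle : subbundle F D2;
  D0_bundle : subbundle F D0;
  Dbar_bundle : subbundle F Dbar;
  L_bundle : subbundle F L;
  S_bundle : subbundle F S;
  Rad_decomp : forall p, direct_sum (RadM p) (D1 p) (D2 p);
  phi_D1 : forall p, (phi (F p) @: D1 p)%VS = D1 p;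
  phi_D2 : forall p, (phi (F p) @: D2 p <= STM p)%VS;
  STM_decomp : forall p,
    direct_sum (STM p) (phi (F p) @: D2 p + Dbar p)%VS (D0 p);
  D0_orthogonal : forall p,
    orthogonal_to (g (F p)) (phi (F p) @: D2 p + Dbar p)%VS (D0 p);
  phi_D0 : forall p, (phi (F p) @: D0 p <= D0 p)%VS;
  Dbar_decomp : forall p,
    Dbar p = (phi (F p) @: S p + phi (F p) @: L p)%VS;
  D0_nondegenerate : forall p, nondegenerate (g (F p)) (D0 p);
  L_sub : forall p, (L p <= ltr p)%VS;
  S_sub : forall p, (S p <= STMperp p)%VS }.

Definition proper_qgcr : Prop :=
  exists D1 D2 D0 Dbar L S : dist n.*2.+1 M,
    qgcr D1 D2 D0 Dbar L S /\
    [/\ nonzero D0, nonzero D1, nonzero D2 & nonzero S].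

Definition xi_transversal : Prop := forall p : M, xi (F p) \in tr p.

End Lightlike.

(* Main.v *)
From HB Require Import structures.
From mathcomp Require Import all_boot all_order all_algebra.
From mathcomp Require Import all_classical all_reals all_analysis.
From mathcomp Require Import ring.
Require Import Defs.

(* Write eta for the 1-form dual to xi.  As xi is transversal, eta vanishes on
   S(TM), and eta o phi = 0; so pairing the nearly Sasakian identity with xi
   gives, for sections X, Y of D_0,
     eta(nabla_X (phi Y)) + eta(nabla_Y (phi X)) = 2 g(X, Y).
   The two umbilicity conditions say that eta(nabla_X Z) = c g(X, Z) for every
   section Z of S(TM), where c = eta(H) + sum_i K_i eta(E_i) does not depend on
   X and Z.  Since phi preserves D_0 and is skew for g, the left-hand side is
   c (g(X, phi Y) + g(Y, phi X)) = 0.  Hence g vanishes on D_0, which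
   contradicts its non-degeneracy.

   The nearly Sasakian identity is available only for vector fields on open sets
   of the ambient manifold; it is transferred to fields along M by expanding
   them in the coordinate fields of a chart, the derivatives of the coefficients
   being killed by eta o phi = 0. *)

Set Implicit Arguments.
Unset Strict Implicit.
Unset Printing Implicit Defensive.

Import Order.TTheory GRing.Theory Num.Theory.
Import numFieldNormedType.Exports.

Local Open Scope classical_set_scope.
Local Open Scope ring_scope.

(** * Smooth functions *)

Section Calculus.
Context {R : realType}.
Implicit Types V W : normedModType R.

(** The difference [g - f] vanishes near [x], so the zero map is its differential there, and [g] is
    a sum of two functions differentiable at [x]. *)
Lemma near_eq_differentiable V W (f g : V -> W) (x : V) :
  (\near x, f x = g x) -> differentiable f x -> differentiable g x.
Proof.
move=> fg df; pose k := g - f.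
have k0 : \near x, k x = 0 by apply: filterS fg => y fgy; rewrite /k !fctE fgy subrr.
have kx : k x = 0 by exact: nbhs_singleton k0.
have dk : k \o shift x = cst (k x) + (0 : V -> W) +o_ 0 id.
  apply/eqaddoP => _/posnumP[e].
  have := k0; rewrite (near_shift 0) => k0'.
  apply: filterS k0' => y /=; rewrite subr0 => ky.
  by rewrite /cst !fctE /= ky kx addr0 subrr normr0 mulr_ge0.
have c0 : continuous (0 : V -> W) by move=> y; exact: cvg_cst.
have -> : g = f + k by apply/funext => y; rewrite /k !fctE addrC subrK.
apply: differentiableD; [exact: df|apply/diff_locallyP].
have := @diff_unique _ _ _ k (\0%R : {linear V -> W}) x c0 dk.
by move=> ->.
Qed.

(** A graded form of [Cinf_on], which opens the closure properties to induction on the order. Order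
    0 already asks for differentiability, so order [k] means [k.+1] times differentiable. *)
Fixpoint Ck_on {V W} (k : nat) (A : set V) (f : V -> W) : Prop :=
  (forall x, A x -> differentiable f x) /\
  if k is k'.+1 then forall v, Ck_on k' A ('D_v f) else True.

Lemma Ck_on_differentiable V W k (A : set V) (f : V -> W) x :
  Ck_on k A f -> A x -> differentiable f x.
Proof. by case: k => [|k] [fA _] /fA. Qed.

Lemma Cinf_onP V W (A : set V) (f : V -> W) :
  Cinf_on A f <-> forall k, Ck_on k A f.
Proof.
split=> [fA k|fA vs].
  elim: k f fA => [|k IHk] f fA /=; split=> //; first exact: (fA [::]).
    exact: (fA [::]).
  move=> v; apply: IHk => vs x Ax.
  by have := fA (rcons vs v) x Ax; rewrite foldr_rcons.
(* The last vector of [vs] is the first direction of derivation, so the sequence is peeled from its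
   end. *)
elim/last_ind: vs f fA => [|vs v IHvs] f fA x Ax /=.
  by have /= [+ _] := fA 0%N; apply.
rewrite foldr_rcons; apply: (IHvs ('D_v f)) => // k.
by have /= [_ +] := fA k.+1; apply.
Qed.

Lemma Ck_on_eq V W k (A : set V) (f g : V -> W) : open A ->
  (forall x, A x -> f x = g x) -> Ck_on k A f -> Ck_on k A g.
Proof.
move=> oA; elim: k f g => [|k IHk] f g fg /= [df Df]; split=> //.
- move=> x Ax; apply: near_eq_differentiable (df x Ax).
  by move: (open_nbhs_nbhs (conj oA Ax)); apply: filterS.
- move=> x Ax; apply: near_eq_differentiable (df x Ax).
  by move: (open_nbhs_nbhs (conj oA Ax)); apply: filterS.
- move=> v; apply: IHk (Df v) => x Ax; apply: near_eq_derive.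
  by move: (open_nbhs_nbhs (conj oA Ax)); apply: filterS.
Qed.

Lemma Ck_onW V W k (A : set V) (f : V -> W) : Ck_on k.+1 A f -> Ck_on k A f.
Proof.
elim: k f => [|k IHk] f [df Df]; first by [].
by split=> // v; apply: IHk.
Qed.

Lemma Ck_on_cst V W k (A : set V) (a : W) : Ck_on k A (cst a).
Proof.
elim: k a => [|k IHk] a /=; split=> // v.
by have -> : 'D_v (cst a) = cst 0 by apply/funext => x; rewrite derive_cst.
Qed.

Lemma Ck_onD V W k (A : set V) (f g : V -> W) : open A ->
  Ck_on k A f -> Ck_on k A g -> Ck_on k A (f + g).
Proof.
move=> oA; elim: k f g => [|k IHk] f g [df Df] [dg Dg].
  by split; [move=> x Ax; apply: differentiableD; [exact: df|exact: dg]|].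
split=> [x Ax|v]; first by apply: differentiableD; [exact: df|exact: dg].
apply: (@Ck_on_eq _ _ _ _ ('D_v f + 'D_v g)) => [//|x Ax|].
  by rewrite deriveD//; apply: diff_derivable; [exact: df|exact: dg].
by apply: IHk; [exact: Df|exact: Dg].
Qed.

Lemma Ck_onM V k (A : set V) (f g : V -> R) : open A ->
  Ck_on k A f -> Ck_on k A g -> Ck_on k A (f * g).
Proof.
move=> oA; elim: k f g => [|k IHk] f g Cf Cg /=.
  by split=> // x Ax; apply: differentiableM;
    [apply: Ck_on_differentiable Cf _ | apply: Ck_on_differentiable Cg _].
have [df Df] := Cf; have [dg Dg] := Cg.
split=> [x Ax|v]; first by apply: differentiableM; [apply: df|apply: dg].
apply: (@Ck_on_eq _ _ _ _ (f * 'D_v g + g * 'D_v f)) => //.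
  move=> x Ax; rewrite deriveM//; apply: diff_derivable;
    [exact: df|exact: dg].
apply: Ck_onD => //; apply: IHk; try exact: Ck_onW; first exact: Dg.
exact: Df.
Qed.

Lemma Ck_on_sum V k (A : set V) d (f : 'I_d -> V -> R) : open A ->
  (forall i, Ck_on k A (f i)) -> Ck_on k A (fun x => \sum_i f i x).
Proof.
move=> oA Cf.
have -> : (fun x => \sum_i f i x) = \sum_i f i.
  by apply/funext => x; rewrite fct_sumE.
elim/big_ind: _ => //; first exact: Ck_on_cst.
by move=> g h; exact: Ck_onD.
Qed.

Lemma diff_coord V d (f : V -> 'rV[R]_d) (i : 'I_d) x : differentiable f x ->
  is_diff x (fun y => f y ord0 i : R) (fun v => 'd f x v ord0 i).
Proof.
move=> df; pose c : 'rV[R]_d -> R := fun N => N ord0 i.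
have lc : linear c by move=> a u w; rewrite /c !mxE.
pose cl := HB.pack_for {linear 'rV[R]_d -> R} c (GRing.isLinear.Build _ _ _ _ c lc).
have cc : continuous cl by exact: coord_continuous.
have dc : differentiable cl (f x) by exact: linear_differentiable.
have -> : (fun y => f y ord0 i) = cl \o f by [].
apply: DiffDef; first exact: differentiable_comp.
by rewrite diff_comp// diff_lin.
Qed.

Lemma Ck_on_coord V k (A : set V) d (f : V -> 'rV[R]_d) (i : 'I_d) : open A ->
  Ck_on k A f -> Ck_on k A (fun x => f x ord0 i).
Proof.
have dfi (h : V -> 'rV[R]_d) x : differentiable h x ->
  differentiable (fun x => h x ord0 i) x by move=> /(diff_coord i)[].
move=> oA; elim: k f => [|k IHk] f [df Df].
  by split; [move=> x Ax; apply: dfi; exact: df|].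
split=> [x Ax|v]; first by apply: dfi; exact: df.
apply: (@Ck_on_eq _ _ _ _ (fun x => 'D_v f x ord0 i)) => [//|x Ax|].
  have Di := diff_coord i (df x Ax).
  by rewrite (deriveE _ (df x Ax)) (deriveE _ (dfi _ _ (df x Ax))) diff_val.
by apply: IHk; exact: Df.
Qed.

Lemma derive_comp V W (W' : normedModType R) (f : V -> W) (g : W -> W') x v :
  differentiable f x -> differentiable g (f x) ->
  'D_v (g \o f) x = 'D_('D_v f x) g (f x).
Proof.
move=> df dg; rewrite (deriveE _ (differentiable_comp df dg)) (deriveE _ dg).
by rewrite (deriveE _ df) diff_comp.
Qed.

Lemma derive_delta d W (g : 'rV[R]_d -> W) x v : differentiable g x ->
  'D_v g x = \sum_i v ord0 i *: 'D_(delta_mx ord0 i) g x.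
Proof.
move=> dg; rewrite deriveE// {1}(row_sum_delta v) linear_sum /=.
by apply: eq_bigr => i _; rewrite linearZ /= deriveE.
Qed.

(** By the chain rule a derivative of [g \o f] is a sum of components of a derivative of [f] times
    partial derivatives of [g] composed with [f]. These composites have lower order, so induction
    applies. *)
Lemma Ck_on_comp V k d (A : set V) (B : set 'rV[R]_d) (f : V -> 'rV[R]_d)
    (g : 'rV[R]_d -> R) : open A -> (forall x, A x -> B (f x)) ->
  Ck_on k A f -> Ck_on k B g -> Ck_on k A (g \o f).
Proof.
move=> oA AB; elim: k f g AB => [|k IHk] f g AB Cf Cg.
  split=> // x Ax; apply: differentiable_comp.
    exact: Ck_on_differentiable Cf _.
  by apply: Ck_on_differentiable Cg _; exact: AB.
have [df Df] := Cf; have [dg Dg] := Cg.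
split=> [x Ax|v].
  by apply: differentiable_comp; [exact: df|exact/dg/AB].
apply: (@Ck_on_eq _ _ _ _ (fun x =>
  \sum_i 'D_v f x ord0 i * 'D_(delta_mx ord0 i) g (f x))) => // [x Ax|].
  have dgx := dg _ (AB x Ax).
  by rewrite (derive_comp _ (df x Ax) dgx) [RHS](derive_delta _ dgx).
apply: Ck_on_sum => // i.
apply: Ck_onM => //; first by apply: Ck_on_coord => //; exact: Df.
by apply: (IHk f ('D_(delta_mx ord0 i) g)); [exact: AB|exact: Ck_onW|exact: Dg].
Qed.

End Calculus.

(** * Closure properties of smooth functions, obtained order by order *)

Section CinfOn.
Context {R : realType}.
Implicit Types V W : normedModType R.

Lemma Cinf_on_differentiable V W (A : set V) (f : V -> W) x :
  Cinf_on A f -> A x -> differentiable f x.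
Proof. by move=> Cf Ax; exact: (Cf [::]). Qed.

Lemma Cinf_on_eq V W (A : set V) (f g : V -> W) : open A ->
  (forall x, A x -> f x = g x) -> Cinf_on A f -> Cinf_on A g.
Proof.
by move=> oA fg /Cinf_onP Cf; apply/Cinf_onP => k; exact: Ck_on_eq fg (Cf k).
Qed.

Lemma Cinf_on_sub V W (A B : set V) (f : V -> W) : A `<=` B ->
  Cinf_on B f -> Cinf_on A f.
Proof. by move=> AB Cf vs x /AB; exact: Cf. Qed.

Lemma Cinf_on_local V W (A : set V) (f : V -> W) :
  (forall x, A x -> exists B, B x /\ Cinf_on B f) -> Cinf_on A f.
Proof. by move=> loc vs x /loc[B [Bx]]; apply. Qed.

Lemma Cinf_on_cst V W (A : set V) (a : W) : Cinf_on A (cst a).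
Proof. by apply/Cinf_onP => k; exact: Ck_on_cst. Qed.

Lemma Cinf_onD V W (A : set V) (f g : V -> W) : open A ->
  Cinf_on A f -> Cinf_on A g -> Cinf_on A (f + g).
Proof.
move=> oA /Cinf_onP Cf /Cinf_onP Cg; apply/Cinf_onP => k.
exact: Ck_onD oA (Cf k) (Cg k).
Qed.

Lemma Cinf_onM V (A : set V) (f g : V -> R) : open A ->
  Cinf_on A f -> Cinf_on A g -> Cinf_on A (f * g).
Proof.
move=> oA /Cinf_onP Cf /Cinf_onP Cg; apply/Cinf_onP => k.
exact: Ck_onM oA (Cf k) (Cg k).
Qed.

Lemma Cinf_on_coord V (A : set V) d (f : V -> 'rV[R]_d) (i : 'I_d) : open A ->
  Cinf_on A f -> Cinf_on A (fun x => f x ord0 i).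
Proof.
by move=> oA /Cinf_onP Cf; apply/Cinf_onP => k; exact: Ck_on_coord oA (Cf k).
Qed.

Lemma Cinf_on_derive V W (A : set V) (f : V -> W) v :
  Cinf_on A f -> Cinf_on A ('D_v f).
Proof.
by move=> Cf vs x Ax; have := Cf (rcons vs v) x Ax; rewrite foldr_rcons.
Qed.

Lemma Cinf_on_comp V d (A : set V) (B : set 'rV[R]_d) (f : V -> 'rV[R]_d)
    (g : 'rV[R]_d -> R) : open A -> (forall x, A x -> B (f x)) ->
  Cinf_on A f -> Cinf_on B g -> Cinf_on A (g \o f).
Proof.
move=> oA AB /Cinf_onP Cf /Cinf_onP Cg; apply/Cinf_onP => k.
exact: Ck_on_comp oA AB (Cf k) (Cg k).
Qed.

End CinfOn.

(** * Charts and coordinate fields *)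

Section Smooth.
Context {R : realType} {d : nat} {M : manifold R d}.
Implicit Types (c : chart R M d) (U V : set M) (f g : M -> R).

Lemma chart_open c U : open U -> open (cmap c @` (cdom c `&` U)).
Proof.
move=> oU.
have -> : cmap c @` (cdom c `&` U) = (cmap c @` cdom c) `&` (cinv c @^-1` U).
  apply/seteqP; split=> x.
    by move=> [p [cp Up] <-]; split; [exists p|rewrite /preimage /= cmapK].
  by move=> [[p cp <-]]; rewrite /preimage /= cmapK// => Up; exists p.
rewrite openE => x [cx Ux].
have ic : {for x, continuous (cinv c)}.
  have := @cinv_continuous _ _ _ c.
  by rewrite continuous_open_subspace; [apply; rewrite inE|exact: cimg_open].
have nx := open_nbhs_nbhs (conj (@cimg_open _ _ _ c) cx).
exact: filterI nx (ic _ (open_nbhs_nbhs (conj oU Ux))).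
Qed.

Lemma chart_nbhs c U p : open U -> U p -> cdom c p ->
  \forall x \near cmap c p, (cdom c `&` U) (cinv c x) /\ cmap c (cinv c x) = x.
Proof.
move=> oU Up cp; have oA := chart_open (c := c) oU.
have Ap : (cmap c @` (cdom c `&` U)) (cmap c p) by exists p.
apply: filterS (open_nbhs_nbhs (conj oA Ap)) => x [q [cq Uq] <-].
by rewrite cmapK.
Qed.

Lemma chart_at_atlas (p : M) : atlas (chart_at p).
Proof. by rewrite /chart_at; case: cid => c []. Qed.

Lemma chart_at_dom (p : M) : cdom (chart_at p) p.
Proof. by rewrite /chart_at; case: cid => c []. Qed.

Lemma smooth_on_sub U V f : U `<=` V -> smooth_on V f -> smooth_on U f.
Proof.
move=> UV sf c ac; apply: Cinf_on_sub (sf c ac).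
by apply: image_subset; exact: setIS.
Qed.

Lemma smooth_on_eq U f g : open U -> (forall p, U p -> f p = g p) ->
  smooth_on U f -> smooth_on U g.
Proof.
move=> oU fg sf c ac; apply: Cinf_on_eq (sf c ac); first exact: chart_open.
by move=> x [p [cp Up] <-] /=; rewrite cmapK// fg.
Qed.

Lemma smooth_on_local U f :
  (forall p, U p -> exists2 V, V p & smooth_on V f) -> smooth_on U f.
Proof.
move=> loc c ac; apply: Cinf_on_local => x [p [cp /loc[V Vp sf] <-]].
by exists (cmap c @` (cdom c `&` V)); split; [exists p|exact: sf].
Qed.

Lemma smooth_on_cst U (a : R) : smooth_on U (cst a).
Proof. by move=> c ac; exact: Cinf_on_cst. Qed.

Lemma smooth_onD U f g : open U -> smooth_on U f -> smooth_on U g ->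
  smooth_on U (fun p => f p + g p).
Proof.
move=> oU sf sg c ac.
by apply: Cinf_onD (sf c ac) (sg c ac); exact: chart_open.
Qed.

Lemma smooth_onM U f g : open U -> smooth_on U f -> smooth_on U g ->
  smooth_on U (fun p => f p * g p).
Proof.
move=> oU sf sg c ac.
by apply: Cinf_onM (sf c ac) (sg c ac); exact: chart_open.
Qed.

(** Compatibility of the atlas lets smoothness be tested in one chart: the expression in [c'] is the
    one in [c] after the transition map. *)
Lemma smooth_on_chart c U f : atlas c -> open U -> U `<=` cdom c ->
  Cinf_on (cmap c @` U) (f \o cinv c) -> smooth_on U f.
Proof.
move=> ac oU Uc sf c' ac'.
have oA := chart_open (c := c') oU.
apply: (@Cinf_on_eq _ _ _ _ ((f \o cinv c) \o (cmap c \o cinv c'))) => //.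
  by move=> x [p [cp Up] <-] /=; rewrite cmapK// cmapK//; exact: Uc.
apply: Cinf_on_comp sf => //.
  by move=> x [p [cp Up] <-] /=; exists p => //; rewrite cmapK.
apply: Cinf_on_sub (atlas_compat ac' ac).
by apply: image_subset; exact: setIS.
Qed.

Lemma transition_differentiable c c' p : atlas c -> atlas c' ->
  cdom c p -> cdom c' p -> differentiable (cmap c' \o cinv c) (cmap c p).
Proof.
by move=> ac ac' cp cp'; apply: Cinf_on_differentiable (atlas_compat ac ac') _; exists p.
Qed.

(** The transformation law of tangent vectors: the chain rule pushes [v] forward by the differential
    of the transition map. *)
Lemma derive_chart (W : normedModType R) (f : M -> W) c c' p v :
  atlas c -> atlas c' -> cdom c p -> cdom c' p ->
  differentiable (f \o cinv c') (cmap c' p) ->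
  'D_v (f \o cinv c) (cmap c p) =
  'D_('D_v (cmap c' \o cinv c) (cmap c p)) (f \o cinv c') (cmap c' p).
Proof.
move=> ac ac' cp cp' df.
have dt := transition_differentiable ac ac' cp cp'.
have e : \forall x \near cmap c p,
    (f \o cinv c) x = ((f \o cinv c') \o (cmap c' \o cinv c)) x.
  apply: filterS (chart_nbhs (cdom_open c') cp' cp) => x [[_ cx'] _] /=.
  by rewrite cmapK.
rewrite (near_eq_derive _ e).
have tp : (cmap c' \o cinv c) (cmap c p) = cmap c' p by rewrite /= cmapK.
have dft : differentiable (f \o cinv c') ((cmap c' \o cinv c) (cmap c p)).
  by rewrite tp.
by rewrite (derive_comp v dt dft) tp.
Qed.

Lemma derive_chart_id c p v : cdom c p ->
  'D_v (cmap c \o cinv c) (cmap c p) = v.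
Proof.
move=> cp; rewrite (near_eq_derive (g := id)) ?derive_id//.
by apply: filterS (chart_nbhs openT I cp) => x [_].
Qed.

(** The coordinate vector field of [c] for its [k]-th coordinate. Tangent vectors at [p] are
    components in [chart_at p], hence the derivative of the transition map from [c]. *)
Definition coord_field c (k : 'I_d) (p : M) : 'rV[R]_d :=
  'D_(delta_mx ord0 k) (cmap (chart_at p) \o cinv c) (cmap c p).

Lemma dird_coord_field c k p f : atlas c -> cdom c p ->
  differentiable (f \o cinv (chart_at p)) (cmap (chart_at p) p) ->
  dird p (coord_field c k p) f =
  'D_(delta_mx ord0 k) (f \o cinv c) (cmap c p).
Proof.
move=> ac cp df; rewrite (derive_chart _ ac (chart_at_atlas p))//.
exact: chart_at_dom.
Qed.

Lemma coord_differentiable c c' p i : atlas c -> atlas c' ->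
  cdom c p -> cdom c' p ->
  differentiable ((fun x => cmap c' x ord0 i) \o cinv c) (cmap c p).
Proof.
by move=> ac ac' cp cp';
  have [] := diff_coord i (transition_differentiable ac ac' cp cp').
Qed.

Lemma coord_at_differentiable c p i : atlas c -> cdom c p ->
  differentiable ((fun x => cmap c x ord0 i) \o cinv (chart_at p))
    (cmap (chart_at p) p).
Proof.
move=> ac cp; apply: coord_differentiable => //; last exact: chart_at_dom.
exact: chart_at_atlas.
Qed.

(** Carrying [w] from [chart_at p] to [c] and back changes nothing; expanding this round trip on the
    basis vectors in [c] gives the sum. *)
Lemma coord_field_decomp c p (w : 'rV[R]_d) : atlas c -> cdom c p ->
  w = \sum_k dird p w (fun x => cmap c x ord0 k) *: coord_field c k p.
Proof.
move=> ac cp.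
have ap := chart_at_atlas p; have dp := chart_at_dom p.
have dt := transition_differentiable ac ap cp dp.
have dt' := transition_differentiable ap ac dp cp.
rewrite -[LHS](derive_chart_id w dp) (derive_chart _ ap ac)//.
rewrite (derive_delta _ dt); apply: eq_bigr => k _; congr (_ *: _).
have dk := diff_coord k dt'.
by rewrite /dird (deriveE _ dt') (deriveE _ (coord_at_differentiable k ac cp)) diff_val.
Qed.

(** The components in [c'], read in [c], are partial derivatives of the transition map. *)
Lemma vfield_coord_field c k : atlas c -> vfield (cdom c) (coord_field c k).
Proof.
move=> ac c' ac' i.
have oU : open (cdom c `&` cdom c') by apply: openI; exact: cdom_open.
apply: (@smooth_on_chart c _ _ ac oU) => [q []//|].
have oA := chart_open (c := c) (cdom_open c').
apply: (@Cinf_on_eq _ _ _ _ ('D_(delta_mx ord0 k)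
  ((fun x => cmap c' x ord0 i) \o cinv c))) => //.
  move=> x [p [cp cp'] <-] /=; rewrite cmapK// dird_coord_field//.
  exact: coord_at_differentiable.
apply: Cinf_on_derive; apply: (@Cinf_on_coord _ _ _ _ (cmap c' \o cinv c)) => //.
exact: atlas_compat.
Qed.

Lemma dirdD c p i (u v : 'rV[R]_d) : atlas c -> cdom c p ->
  dird p (u + v) (fun x => cmap c x ord0 i) =
  dird p u (fun x => cmap c x ord0 i) + dird p v (fun x => cmap c x ord0 i).
Proof.
move=> ac cp; have df := coord_at_differentiable i ac cp.
by rewrite /dird !deriveE// linearD.
Qed.

Lemma dirdZ c p i a (u : 'rV[R]_d) : atlas c -> cdom c p ->
  dird p (a *: u) (fun x => cmap c x ord0 i) =
  a * dird p u (fun x => cmap c x ord0 i).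
Proof.
move=> ac cp; have df := coord_at_differentiable i ac cp.
by rewrite /dird !deriveE// linearZ.
Qed.

Lemma dird_near_cst p (v : 'rV[R]_d) U f a : open U -> U p ->
  (forall q, U q -> f q = a) -> dird p v f = 0.
Proof.
move=> oU Up fa; rewrite /dird (near_eq_derive (g := cst a)) ?derive_cst//.
by apply: filterS (chart_nbhs oU Up (chart_at_dom p)) => x [[_ Ux] _]; exact: fa.
Qed.

End Smooth.

(** * Fields along a map *)

Section Along.
Context {R : realType} {m d : nat} {M : manifold R m} {N : manifold R d}.
Context (F : M -> N).
Implicit Types (U V : set M) (Y Z : M -> 'rV[R]_d).

Lemma smooth_on_comp (V : set N) (f : N -> R) : smooth_map F -> open V ->
  smooth_on V f -> smooth_on (F @^-1` V) (f \o F).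
Proof.
move=> [cF sF] oV sf; apply: smooth_on_local => p Vp.
have [c' [ac' cp']] := atlas_cover (F p).
exists (F @^-1` (cdom c' `&` V)) => // c ac.
have oA : open (cmap c @` (cdom c `&` F @^-1` (cdom c' `&` V))).
  apply: chart_open; apply: open_comp; first by move=> x _; exact: cF.
  by apply: openI => //; exact: cdom_open.
apply: (@Cinf_on_eq _ _ _ _ ((f \o cinv c') \o (cmap c' \o F \o cinv c))) => //.
  by move=> x [q [cq [cq' Vq]] <-] /=; rewrite cmapK// cmapK.
apply: Cinf_on_comp (sf c' ac') => //.
  by move=> x [q [cq [cq' Vq]] <-] /=; exists (F q) => //; rewrite cmapK.
apply: Cinf_on_sub (sF c c' ac ac').
by apply: image_subset; apply: setIS => q [].
Qed.

Lemma smooth_along_comp (V : set N) (Z : N -> 'rV[R]_d) : smooth_map F ->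
  open V -> vfield V Z -> smooth_along F (F @^-1` V) (Z \o F).
Proof.
move=> sF oV sZ c ac i.
have oVc : open (V `&` cdom c) by apply: openI => //; exact: cdom_open.
exact: (smooth_on_comp sF oVc (sZ c ac i)).
Qed.

Lemma smooth_along_sub U V Y : U `<=` V -> smooth_along F V Y ->
  smooth_along F U Y.
Proof.
by move=> UV sY c ac i; apply: smooth_on_sub (sY c ac i); exact: setSI.
Qed.

Hypothesis cF : continuous F.

Let oc U c : open U -> open (U `&` F @^-1` @cdom R N d c).
Proof.
move=> oU; apply: openI => //; apply: open_comp; last exact: cdom_open.
by move=> x _; exact: cF.
Qed.

Lemma smooth_along_eq U Y Z : open U -> (forall q, U q -> Y q = Z q) ->
  smooth_along F U Y -> smooth_along F U Z.
Proof.
move=> oU YZ sY c ac i; apply: smooth_on_eq (sY c ac i); first exact: oc.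
by move=> q [Uq _]; rewrite YZ.
Qed.

Lemma smooth_alongD U Y Z : open U -> smooth_along F U Y ->
  smooth_along F U Z -> smooth_along F U (fun q => Y q + Z q).
Proof.
move=> oU sY sZ c ac i.
apply: smooth_on_eq (smooth_onD _ (sY c ac i) (sZ c ac i)); try exact: oc.
by move=> q [Uq cq]; rewrite dirdD.
Qed.

Lemma smooth_alongZ U f Y : open U -> smooth_on U f ->
  smooth_along F U Y -> smooth_along F U (fun q => f q *: Y q).
Proof.
move=> oU sf sY c ac i.
apply: smooth_on_eq (smooth_onM _ _ (sY c ac i)); try exact: oc.
  by move=> q [Uq cq]; rewrite dirdZ.
by apply: smooth_on_sub sf => q [].
Qed.

Lemma smooth_along0 U : open U -> smooth_along F U (fun=> 0).
Proof.
move=> oU c ac i; apply: (smooth_on_eq (f := cst 0)); first exact: oc.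
  by move=> q [Uq cq]; rewrite /dird derive0.
exact: smooth_on_cst.
Qed.

Lemma smooth_along_sum U n (Y : 'I_n -> M -> 'rV[R]_d) : open U ->
  (forall i, smooth_along F U (Y i)) ->
  smooth_along F U (fun q => \sum_i Y i q).
Proof.
move=> oU sY; have -> : (fun q => \sum_i Y i q) = \sum_i Y i.
  by apply/funext => q; rewrite fct_sumE.
elim/big_ind: _ => [|Z Z'|i _]; [exact: smooth_along0| |exact: sY].
exact: smooth_alongD.
Qed.

(** * Connections along a map: locality and finite sums *)

Section Connection.
Context (D : M -> 'rV[R]_m -> (M -> 'rV[R]_d) -> 'rV[R]_d).
Hypothesis cD : connection F D.

(* Both sections agree after multiplication by the (locally smooth) indicator
   function of [U], on which the Leibniz rule applies. *)
Lemma connection_local U p v Y Z : open U -> U p -> smooth_along F U Y ->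
  (forall q, U q -> Y q = Z q) -> D p v Y = D p v Z.
Proof.
move=> oU Up sY YZ; pose f q : R := (`[< U q >])%:R.
have fU q : U q -> f q = 1 by move=> Uq; rewrite /f asboolT.
have sf : smooth_on U f.
  by apply: (smooth_on_eq (f := cst 1)) => // [q /fU ->//|]; exact: smooth_on_cst.
have fYZ : (fun q => f q *: Y q) = (fun q => f q *: Z q).
  apply/funext => q; rewrite /f; case: asboolP => [/YZ->//|_].
  by rewrite !scale0r.
have Df := dird_near_cst v oU Up fU.
have := cn_leibniz cD v oU Up sf sY.
rewrite fYZ (cn_leibniz cD v oU Up sf (smooth_along_eq oU YZ sY)).
by rewrite Df (fU _ Up) !scale0r !add0r !scale1r.
Qed.

Lemma connection0 U p v : open U -> U p -> D p v (fun=> 0) = 0.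
Proof.
move=> oU Up; have s0 := smooth_along0 oU.
have := cn_add cD v oU Up s0 s0.
have -> : (fun q : M => 0 + 0 : 'rV[R]_d) = (fun=> 0).
  by apply/funext => q; rewrite addr0.
by move/eqP; rewrite -subr_eq subrr eq_sym => /eqP.
Qed.

Lemma connection_sum U p v n (Y : 'I_n -> M -> 'rV[R]_d) : open U -> U p ->
  (forall i, smooth_along F U (Y i)) ->
  D p v (fun q => \sum_i Y i q) = \sum_i D p v (Y i).
Proof.
move=> oU Up sY.
have -> : (fun q => \sum_i Y i q) = \sum_i Y i.
  by apply/funext => q; rewrite fct_sumE.
(* Smoothness of the partial sums is carried along, since [cn_add] applies to smooth sections
   only. *)
suff [] : smooth_along F U (\sum_i Y i) /\ D p v (\sum_i Y i) = \sum_i D p v (Y i).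
  by [].
elim/big_ind2: _ => [|Z z Z' z' [sZ <-] [sZ' <-]|//].
  by split; [exact: smooth_along0|exact: connection0 oU Up].
by split; [exact: smooth_alongD|exact: (cn_add cD v oU Up sZ sZ')].
Qed.

End Connection.

End Along.

(** * Linear and bilinear forms on row vectors *)

Section ScalarForms.
Context {R : realType} {d : nat}.
Implicit Types (f : 'rV[R]_d -> R) (B : 'rV[R]_d -> 'rV[R]_d -> R).
Implicit Types (U V : {vspace 'rV[R]_d}).

Lemma scalar_fun_sum f n (a : 'I_n -> R) (w : 'I_n -> 'rV[R]_d) : scalar f ->
  f (\sum_i a i *: w i) = \sum_i a i * f (w i).
Proof.
move=> lf; pose fl := HB.pack_for {linear 'rV[R]_d -> R^o} f
  (GRing.isLinear.Build _ _ _ _ (f : 'rV[R]_d -> R^o) lf).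
rewrite -[LHS]/(fl _) linear_sum; apply: eq_bigr => i _.
by rewrite linearZ.
Qed.

Lemma scalar_funD f u v : scalar f -> f (u + v) = f u + f v.
Proof. by move=> lf; rewrite -[u]scale1r lf scale1r /= mul1r. Qed.

Lemma scalar_fun0 f : scalar f -> f 0 = 0.
Proof.
move=> lf; have := scalar_funD 0 0 lf; rewrite addr0 => /eqP.
by rewrite -subr_eq subrr eq_sym => /eqP.
Qed.

Lemma scalar_funZ f a u : scalar f -> f (a *: u) = a * f u.
Proof. by move=> lf; rewrite -[_ *: _]addr0 lf scalar_fun0// addr0. Qed.

Lemma scalar_funN f u : scalar f -> f (- u) = - f u.
Proof. by move=> lf; rewrite -scaleN1r scalar_funZ// mulN1r. Qed.

Lemma basis_of_sum (U : {vspace 'rV[R]_d}) k (X : 'I_k -> 'rV[R]_d) u :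
  basis_of U [tuple X i | i < k] -> u \in U ->
  u = \sum_i coord [tuple X i | i < k] i u *: X i.
Proof.
move=> bX uU; rewrite {1}(coord_basis bX uU); apply: eq_bigr => i _.
by rewrite -tnth_nth tnth_mktuple.
Qed.

(** [orthv B U] is the kernel of a linear map into a space of dimension [\dim U]. When it is zero
    the map is injective, so the ambient dimension is at most [\dim U]. *)
Lemma fullv_of_orthogonal B U : (forall u, scalar (fun v => B v u)) ->
  (forall u, scalar (B u)) ->
  (forall w, (forall u, u \in U -> B w u = 0) -> w = 0) -> U = fullv.
Proof.
move=> Bl Br U0; apply/eqP; rewrite eqEdim subvf /=.
have K0 : orthv B U = 0%VS.
  apply/eqP; rewrite -subv0; apply/subvP => w.
  by move=> /(memv_orthv _ _ Bl Br) /U0 ->; exact: mem0v.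
have := limg_ker_dim (linfun (fun w => \row_(i < \dim U) B w (vbasis U)`_i)) fullv.
rewrite capfv -/(orthv B U) K0 dimv0 add0n => <-.
by apply: leq_trans (dimvS (subvf _)) _; rewrite dimvf /dim /= mul1n.
Qed.

End ScalarForms.

(** * The nearly Sasakian identity along a map *)

Section NearlySasakian.
Context {R : realType} {n : nat} (N : nearly_sasakian R n).
Implicit Types p : N.
Local Notation T := 'rV[R]_n.*2.+1.

Lemma gbar_linearl p u : scalar (fun v => gbar p v u).
Proof. exact: sr_linear (gbar_semi_riemannian N) p u. Qed.

Lemma gbarC p u v : gbar p u v = gbar p v u.
Proof. exact: sr_sym (gbar_semi_riemannian N) p u v. Qed.

Lemma gbar_linearr p u : scalar (gbar p u).
Proof. by move=> a v w; rewrite gbarC gbar_linearl /= ![gbar p _ u]gbarC. Qed.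

(** Metric compatibility with first argument [xi p], which [phi] kills. *)
Lemma eta_gbar p u : eta p u = gbar p (xi p) u.
Proof.
have := gbar_phi p (xi p) u; rewrite phi_xi eta_xi mul1r.
by rewrite (scalar_fun0 (gbar_linearl _ _)) => /eqP; rewrite eq_sym subr_eq0 => /eqP.
Qed.

(** Metric compatibility for [u] and [phi p v]; the [xi] term of [phi_sqr] drops out because
    [phi p u] is orthogonal to [xi p]. *)
Lemma gbar_phi_skew p u v : gbar p (phi p u) v = - gbar p u (phi p v).
Proof.
have := gbar_phi p u (phi p v); rewrite eta_phi mulr0 subr0 phi_sqr => <-.
rewrite (scalar_funD _ _ (gbar_linearr _ _)) (scalar_funZ _ _ (gbar_linearr _ _)).
rewrite [gbar p _ (xi p)]gbarC -eta_gbar eta_phi mulr0 addr0.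
by rewrite (scalar_funN _ (gbar_linearr _ _)) opprK.
Qed.

Lemma gbar_phi_diag u v p : gbar p u (phi p v) + gbar p v (phi p u) = 0.
Proof. by rewrite [gbar p v _]gbarC gbar_phi_skew subrr. Qed.

Lemma eta_nearly_sasakian U p X Y : open U -> U p ->
  vfield U X -> vfield U Y ->
  eta p (nablabar p (X p) (fun q => phi q (Y q))) +
  eta p (nablabar p (Y p) (fun q => phi q (X q))) =
  2 * (gbar p (X p) (Y p) - eta p (X p) * eta p (Y p)).
Proof.
move=> oU Up sX sY; have le := @eta_linear _ _ N p.
have := congr1 (eta p) (nearly_sasakianE oU Up sX sY).
rewrite /= !(scalar_funD _ _ le) !(scalar_funN _ le).
rewrite !(scalar_funZ _ _ le) !eta_phi eta_xi oppr0 !addr0 mulr1 => ->.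
ring.
Qed.

Context {m : nat} {M : manifold R m} (F : M -> N).
Context (D : M -> 'rV[R]_m -> (M -> T) -> T).
Hypothesis sF : smooth_map F.
Hypothesis pD : pullback_connection F (@nablabar R n N) D.

Let along_coord (c : chart R N n.*2.+1) (X : M -> T) k q :=
  dird (F q) (X q) (fun x => cmap c x ord0 k).

Let along_phi_decomp c (X : M -> T) q : atlas c -> cdom c (F q) ->
  phi (F q) (X q) = \sum_k along_coord c X k q *: phi (F q) (coord_field c k (F q)).
Proof.
move=> ac cq; rewrite {1}(coord_field_decomp (X q) ac cq) linear_sum.
by apply: eq_bigr => k _; rewrite linearZ.
Qed.

Let vfield_phi_coord c k : atlas c ->
  vfield (cdom c) (fun y : N => phi y (coord_field c k y)).
Proof.
by move=> ac; apply: phi_smooth; [exact: cdom_open|exact: vfield_coord_field].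
Qed.

Let open_pre c U : open U -> open (U `&` F @^-1` @cdom R N n.*2.+1 c).
Proof.
move=> oU; apply: openI => //; apply: open_comp; last exact: cdom_open.
by move=> x _; exact: sF.1.
Qed.

Let smooth_term c U X k : atlas c -> open U -> smooth_along F U X ->
  smooth_along F (U `&` F @^-1` cdom c) (fun q =>
    along_coord c X k q *: phi (F q) (coord_field c k (F q))).
Proof.
move=> ac oU sX; apply: smooth_alongZ; [exact: sF.1|exact: open_pre|exact: sX|].
apply: (@smooth_along_sub _ _ _ _ _ _ _ (F @^-1` cdom c)) => [q []//|].
apply: (smooth_along_comp (Z := fun y => phi y (coord_field c k y)) sF).
  exact: cdom_open.
exact: vfield_phi_coord.
Qed.

(** [phi_smooth] speaks of fields on the ambient manifold; expanding [X] in the coordinate fields of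
    [c] reduces to those, over the chart domain. *)
Lemma smooth_along_phi c U X : atlas c -> open U -> smooth_along F U X ->
  smooth_along F (U `&` F @^-1` cdom c) (fun q => phi (F q) (X q)).
Proof.
move=> ac oU sX.
apply: (@smooth_along_eq _ _ _ _ _ _ sF.1 _ (fun q =>
    \sum_k along_coord c X k q *: phi (F q) (coord_field c k (F q)))).
- exact: open_pre.
- by move=> q [_ cq]; rewrite -along_phi_decomp.
- apply: smooth_along_sum; [exact: sF.1|exact: open_pre|].
  by move=> k; exact: smooth_term.
Qed.

(** The point is tensoriality: the right-hand side sees [X] only through its value at [p]. In the
    Leibniz rule the derivative of a coefficient multiplies a vector in the range of [phi], where
    [eta] vanishes; the remaining terms are pulled back from [nablabar]. *)
Lemma eta_along_phi c U (p : M) v X : atlas c -> open U -> U p -> cdom c (F p) ->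
  smooth_along F U X ->
  eta (F p) (D p v (fun q => phi (F q) (X q))) =
  \sum_k along_coord c X k p * eta (F p) (nablabar (F p) (tangent_map F p v)
    (fun y => phi y (coord_field c k y))).
Proof.
move=> ac oU Up cp sX; have [cD DF] := pD.
have oV := open_pre c oU.
have Vp : (U `&` F @^-1` cdom c) p by [].
have le := @eta_linear _ _ N (F p).
have sphi k : smooth_along F (U `&` F @^-1` cdom c)
    ((fun y => phi y (coord_field c k y)) \o F).
  apply: (@smooth_along_sub _ _ _ _ _ _ _ (F @^-1` cdom c)) => [q []//|].
  by apply: smooth_along_comp => //; [exact: cdom_open|exact: vfield_phi_coord].
rewrite (connection_local sF.1 cD v oV Vp (smooth_along_phi ac oU sX) (Z := fun q =>
    \sum_k along_coord c X k q *: phi (F q) (coord_field c k (F q)))); last first.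
  by move=> q [_ cq]; rewrite -along_phi_decomp.
rewrite (connection_sum sF.1 cD v oV Vp); last by move=> k; exact: smooth_term.
transitivity (\sum_k eta (F p) (D p v (fun q => along_coord c X k q *:
    phi (F q) (coord_field c k (F q))))).
  have := scalar_fun_sum (fun=> 1) (fun k => D p v (fun q => along_coord c X k q *:
    phi (F q) (coord_field c k (F q)))) le.
  under eq_bigr do rewrite scale1r.
  by under [X in _ = X -> _]eq_bigr do rewrite mul1r.
apply: eq_bigr => k _.
rewrite (cn_leibniz cD v oV Vp (sX c ac k) (sphi k)) le (scalar_funZ _ _ le) eta_phi.
by rewrite mulr0 add0r (DF (cdom c))//; [exact: cdom_open|exact: vfield_phi_coord].
Qed.

Lemma eta_nearly_sasakian_along U (p : M) v w X Y : open U -> U p ->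
  smooth_along F U X -> smooth_along F U Y ->
  tangent_map F p v = X p -> tangent_map F p w = Y p ->
  eta (F p) (D p v (fun q => phi (F q) (Y q))) +
  eta (F p) (D p w (fun q => phi (F q) (X q))) =
  2 * (gbar (F p) (X p) (Y p) - eta (F p) (X p) * eta (F p) (Y p)).
Proof.
move=> oU Up sX sY vX wY.
have [c [ac cp]] := atlas_cover (F p).
rewrite (eta_along_phi v ac oU Up cp sY) (eta_along_phi w ac oU Up cp sX) vX wY.
pose e k := coord_field c k (F p).
pose a := along_coord c X; pose b := along_coord c Y.
pose S j k := eta (F p) (nablabar (F p) (e j) (fun y => phi y (coord_field c k y))).
have le := @eta_linear _ _ N (F p).
have oc : open (cdom c) by exact: cdom_open.
have Tsum u k : eta (F p) (nablabar (F p) (u p) (fun y => phi y (coord_field c k y)))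
    = \sum_j along_coord c u j p * S j k.
  have lT : scalar (fun z =>
      eta (F p) (nablabar (F p) z (fun y => phi y (coord_field c k y)))).
    move=> x z z' /=; have lc := lc_connection (nablabar_levi_civita N).
    by rewrite (cn_linear lc oc cp (vfield_phi_coord k ac)) le.
  by rewrite {1}(coord_field_decomp (u p) ac cp) (scalar_fun_sum _ _ lT).
have gXY : gbar (F p) (X p) (Y p) = \sum_j \sum_k a j p * b k p * gbar (F p) (e j) (e k).
  rewrite (coord_field_decomp (X p) ac cp) (scalar_fun_sum _ _ (gbar_linearl _ _)).
  apply: eq_bigr => j _.
  rewrite {1}(coord_field_decomp (Y p) ac cp) (scalar_fun_sum _ _ (gbar_linearr _ _)).
  by rewrite mulr_sumr; apply: eq_bigr => k _; rewrite mulrA.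
have eX : eta (F p) (X p) = \sum_j a j p * eta (F p) (e j).
  by rewrite {1}(coord_field_decomp (X p) ac cp) (scalar_fun_sum _ _ le).
have eY : eta (F p) (Y p) = \sum_k b k p * eta (F p) (e k).
  by rewrite {1}(coord_field_decomp (Y p) ac cp) (scalar_fun_sum _ _ le).
(* Both sides are bilinear in the coefficients of [X] and [Y] at [p], so the identity for pairs of
   coordinate fields suffices. The first sum has the index of [Y] outermost and must be exchanged to
   match the second. *)
transitivity (\sum_j \sum_k a j p * b k p * (S j k + S k j)).
  rewrite [X in X + _](eq_bigr (fun k => \sum_j a j p * b k p * S j k)); last first.
    move=> k _; rewrite Tsum mulr_sumr; apply: eq_bigr => j _.
    by rewrite mulrCA mulrA.
  rewrite exchange_big /= -big_split /=; apply: eq_bigr => j _.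
  rewrite Tsum mulr_sumr -big_split /=; apply: eq_bigr => k _.
  by rewrite [X in _ + X]mulrA -mulrDr.
rewrite gXY eX eY mulr_suml -sumrB mulr_sumr; apply: eq_bigr => j _.
rewrite mulr_sumr -sumrB mulr_sumr; apply: eq_bigr => k _.
rewrite (eta_nearly_sasakian oc cp (vfield_coord_field j ac) (vfield_coord_field k ac)).
have ring_id (x y z s t : R) :
    x * y * (2 * (z - s * t)) = 2 * (x * y * z - x * s * (y * t)).
  by ring.
exact: ring_id.
Qed.

End NearlySasakian.

(** * Lightlike submanifolds *)

Section Lightlike.
Context {R : realType} {n : nat} (N : nearly_sasakian R n).
Context (M : lightlike_submanifold N).
Implicit Types p : M.
Local Notation T := 'rV[R]_n.*2.+1.
Local Notation F := (@incl R n N M).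
Local Notation g := (@gbar R n N).
Local Notation RadM := (Rad g F).
Local Notation TMp := (TM F).

Let sF : smooth_map F := (incl_immersion M).1.

Lemma memv_orth_gbar (U : {vspace T}) y w :
  w \in orthv (g y) U <-> (forall u, u \in U -> g y w u = 0).
Proof. by apply: memv_orthv => u; [exact: gbar_linearl|exact: gbar_linearr]. Qed.

Lemma TMperp_orthogonal p u w : u \in TMp p -> w \in TMperp g F p ->
  g (F p) w u = 0.
Proof. by move=> uT /memv_orth_gbar; apply. Qed.

Lemma Rad_subTM p : (RadM p <= TMp p)%VS.
Proof. exact: capvSl. Qed.

Lemma Rad_subTMperp p : (RadM p <= TMperp g F p)%VS.
Proof. exact: capvSr. Qed.

Lemma STM_subTM p : (STM p <= TMp p)%VS.
Proof. by rewrite (STM_compl p).1 addvSr. Qed.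

Lemma STMperp_subTMperp p : (STMperp p <= TMperp g F p)%VS.
Proof. by rewrite (STMperp_compl p).1 addvSr. Qed.

Lemma ltr_point p : exists E Nu : 'I_(ls_rank M) -> T,
  [/\ basis_of (RadM p) [tuple E i | i < ls_rank M],
      basis_of (ltr p) [tuple Nu i | i < ls_rank M],
      forall i j, g (F p) (E i) (Nu j) = (i == j)%:R &
      forall i u, u \in STM p -> g (F p) (Nu i) u = 0].
Proof.
have [U [E [Nu [oU Up [_ bE] [_ bN] EN]]]] := @ltr_frames _ _ _ M p.
exists (E^~ p), (Nu^~ p); split; [exact: bE|exact: bN|..].
- by move=> i j; have [] := EN p Up i j.
- by move=> i u uS; have [_ _ /memv_orth_gbar + _] := EN p Up i i; apply.
Qed.

(** The null sections spanning [ltr] are chosen orthogonal to the screen, and [STMperp] is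
    orthogonal to all of TM. *)
Lemma tr_orthogonal_STM p u w : u \in STM p -> w \in tr p ->
  g (F p) w u = 0.
Proof.
move=> uS /memv_addP[l lL [s sS ->]].
have [E [Nu [_ bN _ NS]]] := ltr_point p.
rewrite (scalar_funD _ _ (gbar_linearl _ _)) [X in _ + X]TMperp_orthogonal ?addr0.
- rewrite (basis_of_sum bN lL) (scalar_fun_sum _ _ (gbar_linearl _ _)).
  by rewrite big1// => i _; rewrite NS// mulr0.
- exact: subvP (STM_subTM p) _ uS.
- exact: subvP (STMperp_subTMperp p) _ sS.
Qed.

(** Pairing a common vector with the radical basis [E] kills its [ltr] coordinates. What is left
    lies in [STMperp] and in TM, hence in the radical, which meets [STMperp] trivially. *)
Lemma TM_cap_tr p : (TMp p :&: tr p = 0)%VS.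
Proof.
apply/eqP; rewrite -subv0; apply/subvP => w.
rewrite memv_cap => /andP[wT /memv_addP[l lL [s sS wE]]].
have [E [Nu [bE bN EN _]]] := ltr_point p.
have sP := subvP (STMperp_subTMperp p) _ sS.
have ERad j : E j \in RadM p.
  have := basis_mem bE (mem_tnth j [tuple E i | i < ls_rank M]).
  by rewrite tnth_mktuple.
have ET j := subvP (Rad_subTM p) _ (ERad j).
have EP j := subvP (Rad_subTMperp p) _ (ERad j).
have lE := basis_of_sum bN lL.
have l0 : l = 0.
  rewrite lE big1// => j _; suff -> : coord [tuple Nu i | i < ls_rank M] j l = 0.
    by rewrite scale0r.
  have := TMperp_orthogonal wT (EP j); rewrite wE (scalar_funD _ _ (gbar_linearr _ _)).
  rewrite [X in _ + X]gbarC (TMperp_orthogonal (ET j) sP) addr0 lE.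
  rewrite (scalar_fun_sum _ _ (gbar_linearr _ _)) (bigD1 j)//= EN eqxx mulr1.
  by rewrite big1 ?addr0 -?lE// => i ij; rewrite EN eq_sym (negbTE ij) mulr0.
have ws : w = s by rewrite wE l0 add0r.
rewrite memv0 -(memv0 w) -(STMperp_compl p).2 memv_cap ws sS andbT.
by rewrite /Rad memv_cap sP andbT -ws.
Qed.

(** A vector orthogonal to the sum lies in [TMperp], so it is a radical part plus a part in
    [STMperp]. Non-degeneracy of [STMperp] kills the latter, pairing with [Nu] the former. *)
Lemma TM_add_tr p : (TMp p + tr p = fullv)%VS.
Proof.
apply: (fullv_of_orthogonal (B := g (F p))); [exact: gbar_linearl|exact: gbar_linearr|].
move=> w w0.
have wP : w \in TMperp g F p.
  by apply/memv_orth_gbar => u uT; apply/w0/(subvP (addvSl _ _)).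
have wtr u : u \in tr p -> g (F p) w u = 0.
  by move=> uT; apply/w0/(subvP (addvSr _ _)).
have [E [Nu [bE bN EN _]]] := ltr_point p.
move: wP; rewrite (STMperp_compl p).1 => /memv_addP[e eR [s sS wE]].
have eT := subvP (Rad_subTM p) _ eR.
have s0 : s = 0.
  apply: (STMperp_nondegenerate sS) => u uS.
  have := wtr u (subvP (addvSr _ _) _ uS).
  rewrite wE (scalar_funD _ _ (gbar_linearl _ _)) gbarC.
  by rewrite (TMperp_orthogonal eT) ?add0r//; exact: (subvP (STMperp_subTMperp p)).
have NL j : Nu j \in ltr p.
  have := basis_mem bN (mem_tnth j [tuple Nu i | i < ls_rank M]).
  by rewrite tnth_mktuple.
have eE := basis_of_sum bE eR.
rewrite wE s0 addr0 eE big1// => j _.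
suff -> : coord [tuple E i | i < ls_rank M] j e = 0 by rewrite scale0r.
have := wtr (Nu j) (subvP (addvSl _ _) _ (NL j)).
rewrite wE s0 addr0 eE (scalar_fun_sum _ _ (gbar_linearl _ _)) (bigD1 j)//= EN eqxx mulr1.
by rewrite big1 ?addr0 -?eE// => i ij; rewrite EN (negbTE ij) mulr0.
Qed.

Hypothesis xi_tr : xi_transversal M.

Lemma eta_STM p u : u \in STM p -> eta (F p) u = 0.
Proof. by move=> uS; rewrite eta_gbar tr_orthogonal_STM. Qed.

(** The derivative splits along Rad TM, S(TM) and tr(TM). The screen part has zero [eta], and the
    two umbilicity conditions make [eta] of the other parts multiples of the metric, with factors
    depending on [p] alone. *)
Lemma eta_nablaM_umbilical p : totally_umbilical M ->
  screen_totally_umbilical M ->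
  exists c : R, forall U v Y, open U -> U p -> smooth_along F U Y ->
    (forall q, U q -> Y q \in STM q) ->
    eta (F p) (nablaM p v Y) = g (F p) (tangent_map F p v) (Y p) * c.
Proof.
move=> [H _ hH] /(_ p)[U0 [E [K [oU0 U0p [_ bE] _ hK]]]].
have le := @eta_linear _ _ N (F p).
exists (\sum_i K i p * eta (F p) (E i p) + eta (F p) (H p)) => U v Y oU Up sY YS.
set w := nablaM p v Y.
pose V := U `&` U0.
have oV : open V by exact: openI.
have Vp : V p by [].
have sYV : smooth_along F V Y by apply: smooth_along_sub sY => q [].
have YT : section F TMp V Y.
  by split=> // q [Uq _]; exact: (subvP (STM_subTM q)) _ (YS q Uq).
have YP q : V q -> Y q = screen_proj Y q.
  move=> [Uq _]; have [_ RS0] := STM_compl q.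
  by rewrite /screen_proj daddv_pi_id ?YS// capvC.
have wE := daddv_pi_add (TM_cap_tr p) (_ : w \in (TMp p + tr p)%VS).
rewrite -{}wE; last by rewrite TM_add_tr memvf.
rewrite (scalar_funD _ _ le) mulrDr; congr (_ + _); last first.
  by rewrite -/(second_form p v Y) (hH V)// (scalar_funZ _ _ le).
set t := daddv_pi _ _ w.
(* [screen_form] differentiates [screen_proj Y], known to agree with [Y] only on [V]; locality of
   the connection bridges the two. *)
have tE : t = gauss_nabla p v (screen_proj Y).
  rewrite /t /gauss_nabla /w.
  by rewrite (connection_local sF.1 (nablaM_pullback M).1 v oV Vp sYV YP).
have [TE RS0] := STM_compl p.
have tT : t \in (RadM p + STM p)%VS by rewrite -TE memv_pi.
rewrite -(daddv_pi_add RS0 tT) (scalar_funD _ _ le).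
rewrite [X in _ + X]eta_STM ?addr0; last exact: memv_pi.
rewrite (basis_of_sum (bE p U0p) (memv_pi (RadM p) (STM p) t)) (scalar_fun_sum _ _ le).
rewrite mulr_sumr; apply: eq_bigr => i _; rewrite mulrA; congr (_ * _).
by rewrite tE -/(screen_form E i p v Y) (hK V)// -?YP// 1?mulrC// => q [].
Qed.

End Lightlike.

(** * Contradiction at a point where D_0 is nonzero *)

Theorem theorem4p7 (R : realType) (n : nat) (N : nearly_sasakian R n) :
  ~ exists M : lightlike_submanifold N,
      [/\ proper_qgcr M, totally_umbilical M, screen_totally_umbilical M
        & xi_transversal M].
Proof.
move=> [M [[D1 [D2 [D0 [Db [L [S [Q [[p D0p] _ _ _]]]]]]]] umb sumb xitr]].
have sF : smooth_map (@incl _ _ _ M) := (incl_immersion M).1.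
have [c0 hc] := eta_nablaM_umbilical xitr p umb sumb.
have [k hk] := D0_bundle Q; have [U [X [oU Up [sX bX]]]] := hk p.
have [c [ac cp]] := atlas_cover (incl p).
pose V := U `&` @incl _ _ _ M @^-1` cdom c.
have oV : open V.
  apply: openI => //; apply: open_comp; last exact: cdom_open.
  by move=> x _; exact: sF.1.
have Vp : V p by [].
have D0S q : (D0 q <= STM q)%VS by rewrite (STM_decomp Q q).1 addvSr.
have XD0 i q : U q -> X i q \in D0 q by move=> /((sX i).2).
have gXX i j : gbar (incl p) (X i p) (X j p) = 0.
  (* [nablaM] takes directions in the tangent space of [M] itself, so the frame vectors are lifted
     through the differential of the inclusion. *)
  have tang l : exists v, tangent_map (@incl _ _ _ M) p v = X l p.
    have /memv_imgP[v _ ->] : X l p \in TM (@incl _ _ _ M) p.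
      exact: subvP (STM_subTM p) _ (subvP (D0S p) _ (XD0 l p Up)).
    by exists v.
  have [v vX] := tang i; have [w wX] := tang j.
  have sphi l := smooth_along_phi sF ac oU (sX l).1.
  have phiS l q : V q -> phi (incl q) (X l q) \in STM q.
    move=> [Uq _]; apply: (subvP (D0S q)); apply: (subvP (phi_D0 Q q)).
    exact/memv_img/XD0.
  have := eta_nearly_sasakian_along sF (nablaM_pullback M) oU Up
    (sX i).1 (sX j).1 vX wX.
  (* The same [c0] serves both terms, so it factors out of a sum that vanishes by skewness of
     [phi]. *)
  rewrite (hc V v _ oV Vp (sphi j) (phiS j)) (hc V w _ oV Vp (sphi i) (phiS i)).
  rewrite vX wX -mulrDl gbar_phi_diag mul0r !(eta_STM xitr) ?mulr0 ?subr0.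
  - by move=> /esym/eqP; rewrite mulf_eq0 pnatr_eq0 /= => /eqP.
  - exact: subvP (D0S p) _ (XD0 j p Up).
  - exact: subvP (D0S p) _ (XD0 i p Up).
(* The frame spans D_0 at [p], so the metric vanishes on it; non-degeneracy then makes D_0 zero at
   [p], against the choice of [p]. *)
move/negP: D0p; apply; rewrite -subv0; apply/subvP => u uD; rewrite memv0.
apply/eqP; apply: (D0_nondegenerate Q uD) => v vD.
rewrite (basis_of_sum (bX p Up) uD) (scalar_fun_sum _ _ (gbar_linearl _ _)).
rewrite big1// => i _.
rewrite (basis_of_sum (bX p Up) vD) (scalar_fun_sum _ _ (gbar_linearr _ _)).
rewrite big1 ?mulr0// => j _.
by rewrite gXX mulr0.
Qed.
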